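(* Let $X$ be a two-sided quaternionic Banach space, $\mathbb{B}=\{q\in\mathbb{H}:|q|<1\}$, and $T\in\mathcal{B}(X)$. Suppose that $\sigma_S(T)\cap\partial\mathbb{B}\subseteq\{1\}$, that every $s\in\mathbb{H}$ with $|s|>1$ lies in $\rho_S(T)$, and that there exist constants $C>0$ and $0<\alpha\le1$ such that $$\|S_L^{-2}(s,T)\|\le\frac{C}{|s-1|^{1+\alpha}}\quad\text{for all } s\in\mathbb{H}\text{ with }|s|>1.$$ Then $T$ is power-bounded, i.e. $\sup_{n\in\mathbb{N}}\|T^n\|<\infty$.
   Context: $\mathbb{N}$ is the set of positive integers. $\mathbb{H}$ denotes the real algebra of quaternions; for $s\in\mathbb{H}$, $\overline{s}$ is its conjugate, $\mathrm{Re}(s)$ its real part, $|s|$ its modulus. $X$ is a two-sided vector space over $\mathbb{H}$ which is a Banach space; $\mathcal{B}(X)$ is the algebra of bounded right $\mathbb{H}$-linear operators on $X$ with identity $\mathcal{I}$ and operator norm; $(sT)(v)=s(Tv)$, $(Ts)(v)=T(sv)$. For $s\in\mathbb{H}$ put $Q_s(T)=T^2-2\mathrm{Re}(s)T+|s|^2\mathcal{I}$; $\rho_S(T)=\{s\in\mathbb{H}: Q_s(T)\text{ invertible in }\mathcal{B}(X)\}$ and $\sigma_S(T)=\mathbb{H}\setminus\rho_S(T)$ (the $S$-spectrum). For $s\in\rho_S(T)$, $$S_L^{-2}(s,T)=Q_s(T)^{-2}\big(\overline{s}^{\,2}\mathcal{I}-2T\overline{s}+T^2\big).$$ *)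

(* Defs.v *)
From HB Require Import structures.
From mathcomp Require Import all_boot all_order all_algebra.
From mathcomp Require Import all_classical all_reals all_analysis.
Set Implicit Arguments. Unset Strict Implicit. Unset Printing Implicit Defensive.
Import Order.TTheory GRing.Theory Num.Theory.
Import numFieldNormedType.Exports.
Local Open Scope ring_scope.

Record quat (R : Type) := Quat { qre : R; qi : R; qj : R; qk : R }.

Section Quaternions.
Variable R : realType.
Implicit Types p q : quat R.

Definition qofR (r : R) : quat R := Quat r 0 0 0.
Definition qadd p q : quat R :=
  Quat (qre p + qre q) (qi p + qi q) (qj p + qj q) (qk p + qk q).
Definition qopp p : quat R := Quat (- qre p) (- qi p) (- qj p) (- qk p).
Definition qsub p q : quat R := qadd p (qopp q).
Definition qmul p q : quat R :=
  Quat (qre p * qre q - qi p * qi q - qj p * qj q - qk p * qk q)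
       (qre p * qi q + qi p * qre q + qj p * qk q - qk p * qj q)
       (qre p * qj q - qi p * qk q + qj p * qre q + qk p * qi q)
       (qre p * qk q + qi p * qj q - qj p * qi q + qk p * qre q).
Definition qconj p : quat R := Quat (qre p) (- qi p) (- qj p) (- qk p).
Definition qnorm p : R :=
  Num.sqrt (qre p ^+ 2 + qi p ^+ 2 + qj p ^+ 2 + qk p ^+ 2).
End Quaternions.

Record two_sided_qbanach (R : realType) (X : completeNormedModType R)
  (lm : quat R -> X -> X) (rm : X -> quat R -> X) : Prop := {
  lm_addl : forall p q v, lm (qadd p q) v = lm p v + lm q v;
  lm_addr : forall p u v, lm p (u + v) = lm p u + lm p v;
  lm_mul  : forall p q v, lm (qmul p q) v = lm p (lm q v);
  lm_one  : forall v, lm (qofR 1) v = v;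
  rm_addl : forall u v q, rm (u + v) q = rm u q + rm v q;
  rm_addr : forall v p q, rm v (qadd p q) = rm v p + rm v q;
  rm_mul  : forall v p q, rm v (qmul p q) = rm (rm v p) q;
  rm_one  : forall v, rm v (qofR 1) = v;
  lm_rm   : forall p v q, lm p (rm v q) = rm (lm p v) q;
  lm_real : forall (r : R) v, lm (qofR r) v = r *: v;
  rm_real : forall (r : R) v, rm v (qofR r) = r *: v;
  lm_norm : forall p v, `|lm p v| = qnorm p * `|v|;
  rm_norm : forall p v, `|rm v p| = `|v| * qnorm p
}.

Section Operators.
Variables (R : realType) (X : completeNormedModType R)
  (lm : quat R -> X -> X) (rm : X -> quat R -> X).

Definition opnorm_le (A : X -> X) (K : R) : Prop :=
  forall v, `|A v| <= K * `|v|.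

Definition in_BX (A : X -> X) : Prop :=
  (forall u v, A (u + v) = A u + A v) /\
  (forall v q, A (rm v q) = rm (A v) q) /\
  (exists K : R, opnorm_le A K).

Definition BX_inverse (B A : X -> X) : Prop :=
  in_BX B /\ (forall v, B (A v) = v) /\ (forall v, A (B v) = v).

Definition Qs (s : quat R) (T : X -> X) : X -> X :=
  fun v => T (T v) - (2 * qre s) *: T v + (qnorm s ^+ 2) *: v.

Definition rhoS (T : X -> X) (s : quat R) : Prop :=
  exists B, BX_inverse B (Qs s T).

(** S_L^{-2}(s,T) = Q_s(T)^{-2} ( sbar^2 I - 2 T sbar + T^2 ),
    computed with a given inverse B of Q_s(T) in B(X) (which is unique). *)
Definition SL2 (B : X -> X) (s : quat R) (T : X -> X) : X -> X :=
  fun v => B (B (lm (qmul (qconj s) (qconj s)) v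
                 - 2%:R *: T (lm (qconj s) v) + T (T v))).

Definition power_bounded (T : X -> X) : Prop :=
  exists M : R, forall n : nat, opnorm_le (iter n T) M.
End Operators.

(* Main.v *)
(* Put (f o (s - T)) v := f (s v) - T (f v).  On a slice C_i the operator
   S = S_L^{-2}(s,T) satisfies S o (s - T) o (s - T) = I.  Let A_j be the average,
   over the N points s of modulus r > 1 whose argument is a multiple of 2 pi / N,
   of S (s^j v) / r^j.  These averages are periodic in j of period N, and
   b_j = r A_{j+1} - T A_j satisfies r b_{j+1} - T b_j = v if N divides j, and 0
   otherwise.  Solving this recurrence expresses (n+1) T^n v through A_{n+2}, up
   to terms of size m |T^m| / r^m with m ~ N.  As alpha <= 1, the bound on
   S_L^{-2} is at most a multiple of the Poisson kernel 1/|s-1|^2, so that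
   |A_j| <= 3 C |v| / (r - 1).

   If |T^m| = O(r0^m) with r0 < r, then letting N tend to infinity gives
   (n+1) |T^n| <= 3 C r^{n+2} / (r - 1).  The factor n+1 makes |T^n| < p^n r0^n
   for some n and p < 1, so the growth rate r0 can be lowered until it reaches any
   value above 1; hence the estimate holds for all r > 1, and r = 1 + 1/(n+1)
   bounds |T^n|. *)
Require Import Defs.
From HB Require Import structures.
From mathcomp Require Import all_boot all_order all_algebra.
From mathcomp Require Import all_classical all_reals all_analysis.
From mathcomp Require Import ring lra.
Import Order.TTheory GRing.Theory Num.Theory.
Import numFieldNormedType.Exports.
Local Open Scope ring_scope.
Set Implicit Arguments. Unset Strict Implicit. Unset Printing Implicit Defensive.

(** * Trigonometric sums over roots of unity and a discrete Poisson kernel *)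

Lemma sum_shift (V : zmodType) (f : nat -> V) (N : nat) :
  f N = f 0%N -> \sum_(k < N) f k.+1 = \sum_(k < N) f k.
Proof.
move=> f0N; apply/eqP; rewrite -subr_eq0 -sumrB.
rewrite -(big_mkord xpredT (fun k => f k.+1 - f k)) telescope_sumr //.
by rewrite f0N subrr.
Qed.

Section TrigonometricSums.
Variable R : realType.
Implicit Types (j k N : nat) (t r x : R).

Definition root_angle N : R := pi *+ 2 / N%:R.

Lemma root_angleM N k : (0 < N)%N -> (k * N)%:R * root_angle N = (pi *+ 2) *+ k.
Proof.
move=> N0; have : N%:R != 0 :> R by rewrite pnatr_eq0 -lt0n.
by move=> N0'; rewrite /root_angle natrM -[RHS]mulr_natl; field.
Qed.

Lemma root_angle_shift N j k : (0 < N)%N ->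
  ((j + N) * k)%:R * root_angle N = (j * k)%:R * root_angle N + (pi *+ 2) *+ k.
Proof. by move=> N0; rewrite mulnDl natrD mulrDl (mulnC N) root_angleM. Qed.

Lemma root_angle_cos_neq1 N j : (0 < j < N)%N ->
  cos (j%:R * root_angle N) != 1.
Proof.
move=> /andP[j0 jN]; have N0 : (0 < N)%N by apply: ltn_trans jN.
have NR : 0 < N%:R :> R by rewrite ltr0n.
have -> : j%:R * root_angle N = (pi * (j%:R / N%:R)) *+ 2.
  by rewrite /root_angle; field; rewrite gt_eqF.
set x := pi * _; have x0 : 0 < sin x.
  apply: sin_gt0_pi; rewrite mulr_gt0 ?pi_gt0 ?divr_gt0 ?ltr0n //=.
  by rewrite -[ltRHS]mulr1 ltr_pM2l ?pi_gt0 // ltr_pdivrMr // mul1r ltr_nat.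
rewrite cos_mulr2n cos2sin2; apply/eqP => h.
by have := exprn_gt0 2 x0; lra.
Qed.

(** Shifting [k] by one rotates the vector of the two sums by the angle [t], and periodicity makes
    it a fixed vector; a rotation with [cos t != 1] fixes only 0. *)
Lemma sum_rotation_eq0 N t : cos t != 1 -> cos (N%:R * t) = 1 ->
  sin (N%:R * t) = 0 ->
  \sum_(k < N) cos (k%:R * t) = 0 /\ \sum_(k < N) sin (k%:R * t) = 0.
Proof.
move=> ct cN sN; set c := \sum_(k < N) _; set s := \sum_(k < N) _.
have ec : c * cos t - s * sin t = c.
  rewrite -[RHS](@sum_shift _ (fun k => cos (k%:R * t))) ?mul0r ?cos0 //.
  rewrite !mulr_suml -sumrB; apply: eq_bigr => k _.
  by rewrite -natr1 mulrDl mul1r cosD.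
have es : s * cos t + c * sin t = s.
  rewrite -[RHS](@sum_shift _ (fun k => sin (k%:R * t))) ?mul0r ?sin0 //.
  rewrite !mulr_suml -big_split; apply: eq_bigr => k _.
  by rewrite -natr1 mulrDl mul1r sinD.
have : (1 - cos t) * (c ^+ 2 + s ^+ 2) = 0.
  by transitivity
   (c * (c - (c * cos t - s * sin t)) + s * (s - (s * cos t + c * sin t)));
    [ring | rewrite ec es; ring].
move=> /eqP; rewrite mulf_eq0 subr_eq0 eq_sym (negPf ct) /=.
by rewrite paddr_eq0 ?sqr_ge0 // !sqrf_eq0 => /andP[/eqP -> /eqP ->].
Qed.

Lemma sum_root_angle N j : (0 < j < N)%N ->
  \sum_(k < N) cos ((j * k)%:R * root_angle N) = 0 /\
  \sum_(k < N) sin ((j * k)%:R * root_angle N) = 0.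
Proof.
move=> jN; have N0 : (0 < N)%N by case/andP: jN; apply: ltn_trans.
have e k : (j * k)%:R * root_angle N = k%:R * (j%:R * root_angle N).
  by rewrite mulnC natrM mulrA.
have [||h1 h2] := sum_rotation_eq0 (N := N) (root_angle_cos_neq1 jN).
- by rewrite -e root_angleM // -[X in cos X]add0r (periodicn (@cosD2pi R)) cos0.
- by rewrite -e root_angleM // -[X in sin X]add0r (periodicn (@sinD2pi R)) sin0.
by split; [rewrite -[RHS]h1|rewrite -[RHS]h2]; apply: eq_bigr => k _; rewrite e.
Qed.

(** The expression is [|r e^(ix) - 1|^2]. *)
Lemma poisson_denom_gt0 r x : 1 < r -> 0 < r ^+ 2 - 2 * r * cos x + 1.
Proof.
move=> r1; have := cos_le1 x => c1.
have -> : r ^+ 2 - 2 * r * cos x + 1 = (r - 1) ^+ 2 + 2 * r * (1 - cos x) by ring.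
by apply: ltr_wpDr; [apply: mulr_ge0; lra | apply: exprn_gt0; lra].
Qed.

(* The cosine moments of the Poisson kernel over the N points solve a periodic
   recurrence of period N, which gives their zeroth term exactly. *)
Lemma discrete_poisson r N : 1 < r -> 2 <= r ^+ N ->
  \sum_(k < N) (r ^+ 2 - 2 * r * cos (k%:R * root_angle N) + 1)^-1
    <= 3 * N%:R / (r ^+ 2 - 1).
Proof.
move=> r1 rN; case: N rN => [|N] rN; first by rewrite big_ord0 mulr0 mul0r.
set w := root_angle N.+1.
pose den k := r ^+ 2 - 2 * r * cos (k%:R * w) + 1.
pose c j := \sum_(k < N.+1) cos ((j * k)%:R * w) / den k.
have den0 k : den k != 0 by rewrite gt_eqF // poisson_denom_gt0.
(* Since [cos ((j+2)x) + cos (jx) = 2 cos x cos ((j+1)x)], this combination rebuilds [den k] in each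
   summand and cancels it. *)
have rec j : (r ^+ 2 + 1) * c j.+1 - r * (c j.+2 + c j) =
     \sum_(k < N.+1) cos ((j.+1 * k)%:R * w).
  rewrite -big_split !mulr_sumr -sumrB; apply: eq_bigr => k _ /=.
  have -> : (j.+2 * k)%:R * w = (j.+1 * k)%:R * w + k%:R * w.
    by rewrite -mulrDl -natrD -[in LHS]addn1 mulnDl mul1n.
  have -> : (j * k)%:R * w = (j.+1 * k)%:R * w - k%:R * w.
    by rewrite -mulrBl -natrB ?mulSn ?leq_addr // addKn.
  rewrite cosD cosB; have := den0 k; rewrite /den => h; by field.
have rec0 : (r ^+ 2 + 1) * c 0%N - 2 * r * c 1%N = N.+1%:R.
  transitivity (\sum_(k < N.+1) (1 : R)); last by rewrite sumr_const card_ord.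
  rewrite /c !mulr_sumr -sumrB; apply: eq_bigr => k _.
  rewrite mul0n mul1n mul0r cos0; have := den0 k; rewrite /den => h; by field.
have per : c N.+1 = c 0%N.
  apply: eq_bigr => k _; congr (_ / _).
  have -> : (N.+1 * k)%:R * w = _ := root_angle_shift 0 k (ltn0Sn N).
  by rewrite (periodicn (@cosD2pi R)).
have sym : c N = c 1%N.
  apply: eq_bigr => k _; congr (_ / _).
  have -> : (N * k)%:R * w = - ((1 * k)%:R * w) + (pi *+ 2) *+ k.
    by rewrite -(root_angleM k (ltn0Sn N)) -/w mul1n mulnS natrD (mulnC k); ring.
  by rewrite (periodicn (@cosD2pi R)) cosN.
(* The homogeneous recurrence has the solutions [r^j] and [r^-j]. The combination [r c_(j+1) - c_j]
   kills the second, so it grows by the factor [r] at each step until [per] and [sym] close the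
   circuit. *)
pose d := r * c 1%N - c 0%N.
have geom j : (j <= N)%N -> r * c j.+1 - c j = r ^+ j * d.
  elim: j => [|j IH] jN; first by rewrite expr0 mul1r.
  have [//|s0 _] := @sum_root_angle N.+1 j.+1.
  rewrite exprS -mulrA -(IH (ltnW jN)); have := rec j; rewrite s0 => h.
  by apply/eqP; rewrite -subr_eq0 -[X in _ == X]oppr0 -h; apply/eqP; ring.
have := geom N (leqnn N); rewrite per sym => eqd.
have c0E : \sum_(k < N.+1) (r ^+ 2 - 2 * r * cos (k%:R * w) + 1)^-1 = c 0%N.
  by apply: eq_bigr => k _; rewrite mul0n mul0r cos0 mul1r.
have r21 : 0 < r ^+ 2 - 1 by rewrite subr_gt0 exprn_egt1.
rewrite c0E ler_pdivlMr //.
have dN : (r ^+ N.+1 - 1) * d = N.+1%:R.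
  by rewrite -rec0 exprS; transitivity (r * (r ^+ N * d) - d);
    [ring | rewrite -eqd /d; ring].
have eN : c 0%N * (r ^+ 2 - 1) = N.+1%:R + 2 * d by rewrite -rec0 /d; ring.
have N1 : 0 < N.+1%:R :> R by rewrite ltr0n.
have d0 : 0 <= d by rewrite -(@pmulr_rge0 _ (r ^+ N.+1 - 1)) ?dN; lra.
(* Here [2 <= r ^+ N.+1] enters; with [eN] it yields the factor [3 = 1 + 2]. *)
have : d <= N.+1%:R by rewrite -dN ler_peMl; lra.
rewrite eN; lra.
Qed.
End TrigonometricSums.

Set Implicit Arguments. Unset Strict Implicit. Unset Printing Implicit Defensive.

(** * Factorization of the quadratic polynomial [Q] of [T] *)

Section Factorization.
Variables (R : realType) (X : lmodType R) (T S S' : {linear X -> X}) (a m : R).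
Hypothesis SS' : forall x, S' (S x) = m *: x.
Hypothesis SDS' : forall x, S x + S' x = (2 * a) *: x.

(* With T acting on the left and S, S' on the right, (S - T) and (S' - T) commute
   as operators on E and their product is multiplication by Q. *)
Lemma star_quadratic (E : {linear X -> X}) x :
  E (S' (S x)) - T (E (S x)) - T (E (S' x) - T (E x))
  = T (T (E x)) - (2 * a) *: T (E x) + m *: E x.
Proof.
have -> : S x = (2 * a) *: x - S' x by rewrite -SDS' addrK.
have -> : S' ((2 * a) *: x - S' x) = m *: x by rewrite -SS' -SDS' addrK.
rewrite !linearB !linearZ /=.
by rewrite !opprK -!addrA addNKr addrC [X in X + _ = _]addrC scalerN addrA.
Qed.

Variable B : {linear X -> X}.
Let Q x := T (T x) - (2 * a) *: T x + m *: x.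
Hypothesis BQ : forall x, B (Q x) = x.
Hypothesis QB : forall x, Q (B x) = x.

Lemma inverse_commute x : T (B x) = B (T x).
Proof.
rewrite -[LHS]BQ; congr (B _).
have -> : Q (T (B x)) = T (Q (B x)) by rewrite /Q linearD linearB !linearZ.
by rewrite QB.
Qed.

(** [W] is [B^2] after the mixed left-right square of [S' - T]. Multiplying by [S - T] turns one
    factor [S' - T] into [Q], which cancels one [B]: hence [W1] is [B (S' - T)], the ordinary left
    S-resolvent, and a second multiplication leaves the identity. *)
Lemma SL2_recurrence (W W1 : X -> X) :
  (forall x, W x = B (B (S' (S' x) - 2%:R *: T (S' x) + T (T x)))) ->
  (forall x, W1 x = W (S x) - T (W x)) ->
  forall x, W1 (S x) - T (W1 x) = x.
Proof.
move=> WE W1E x; pose G : {linear X -> X} := S' \- T.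
have {}WE y : W y = B (B (G (S' y) - T (G y))).
  rewrite WE; congr (B (B _)); rewrite /G /= linearB /= opprB addrA.
  by rewrite scaler_nat mulr2n opprD !addrA [X in _ = X]addrAC.
have {}W1E y : W1 y = B (G y).
  transitivity (B (B (Q (G y)))); last by rewrite BQ.
  rewrite W1E !WE !inverse_commute -!linearB; congr (B (B _)).
  exact: star_quadratic.
rewrite !W1E inverse_commute -linearB -[RHS]BQ; congr (B _).
exact: (star_quadratic [the {linear X -> X} of idfun]).
Qed.
End Factorization.

(** * The operator [SL2] on a complex slice *)

Section Resolvent.
Variables (R : realType) (X : completeNormedModType R)
  (lm : quat R -> X -> X) (rm : X -> quat R -> X).
Hypothesis hX : two_sided_qbanach lm rm.

Lemma in_BX_linear A : in_BX rm A -> linear A.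
Proof.
move=> [AD [Arm _]] c u v; rewrite AD; congr (_ + _).
by rewrite -!(rm_real hX) Arm.
Qed.

Lemma lm_linear p : linear (lm p).
Proof.
move=> c u v; rewrite (lm_addr hX); congr (_ + _).
by rewrite -!(rm_real hX) (lm_rm hX).
Qed.

Lemma SL2_linear B s T : linear B -> linear T -> linear (SL2 lm B s T).
Proof.
move=> hB hT c u v.
pose Bl : {linear X -> X} := HB.pack B (GRing.isLinear.Build R X X *:%R B hB).
pose Tl : {linear X -> X} := HB.pack T (GRing.isLinear.Build R X X *:%R T hT).
pose L p : {linear X -> X} :=
  HB.pack (lm p) (GRing.isLinear.Build R X X *:%R (lm p) (lm_linear p)).
exact: (linearP (Bl \o (Bl \o (L (qmul (qconj s) (qconj s))
   \- (2%:R \*: (Tl \o L (qconj s))) \+ (Tl \o Tl))))).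
Qed.

Definition qcis (t : R) : quat R := Quat (cos t) (sin t) 0 0.

Lemma lm_qcisD t u x : lm (qcis (t + u)) x = lm (qcis t) (lm (qcis u) x).
Proof.
rewrite -(lm_mul hX); congr (lm _ x).
by rewrite /qcis /qmul /= cosD sinD; congr Quat; ring.
Qed.

Lemma qnorm_qcis t : qnorm (qcis t) = 1.
Proof. by rewrite /qnorm /= cos2Dsin2 expr0n /= !addr0 sqrtr1. Qed.

Lemma norm_lm_qcis t x : `|lm (qcis t) x| = `|x|.
Proof. by rewrite (lm_norm hX) qnorm_qcis mul1r. Qed.

Definition qpolar (r t : R) : quat R := qmul (qofR r) (qcis t).

Lemma qpolarE r t : qpolar r t = Quat (r * cos t) (r * sin t) 0 0.
Proof. by rewrite /qpolar /qmul /=; congr Quat; ring. Qed.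

Lemma qnorm_qpolar r t : 0 <= r -> qnorm (qpolar r t) = r.
Proof.
move=> r0; rewrite qpolarE /qnorm /= !exprMn -mulrDr cos2Dsin2 mulr1 expr0n /= !addr0.
by rewrite sqrtr_sqr ger0_norm.
Qed.

Lemma qnorm_qpolar_sub1 r t :
  qnorm (qsub (qpolar r t) (qofR 1)) = Num.sqrt (r ^+ 2 - 2 * r * cos t + 1).
Proof.
rewrite qpolarE /qnorm /=; congr Num.sqrt.
by have /(congr1 ( *%R (r ^+ 2))) := cos2Dsin2 t; rewrite mulr1 => <-; ring.
Qed.

Lemma lm_qpolar r t x : lm (qpolar r t) x = r *: lm (qcis t) x.
Proof. by rewrite /qpolar (lm_mul hX) (lm_real hX). Qed.

(** [S] and [S'] become left multiplication by [s] and by its conjugate, whose sum and product are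
    real. The modulus [r] is pulled out as a real scalar, so that only unit rotations remain inside
    [W]. *)
Lemma slice_recurrence (T : X -> X) r t (B : X -> X) : 0 <= r -> in_BX rm T ->
  BX_inverse rm B (Qs (qpolar r t) T) ->
  let W := SL2 lm B (qpolar r t) T in
  let W1 y := r *: W (lm (qcis t) y) - T (W y) in
  forall x, r *: W1 (lm (qcis t) x) - T (W1 x) = x.
Proof.
move=> r0 hT [hB [BQ QB]] W W1 x.
have lT := in_BX_linear hT; have lB := in_BX_linear hB.
pose Bl : {linear X -> X} := HB.pack B (GRing.isLinear.Build R X X *:%R B lB).
pose Tl : {linear X -> X} := HB.pack T (GRing.isLinear.Build R X X *:%R T lT).
pose L p : {linear X -> X} :=
  HB.pack (lm p) (GRing.isLinear.Build R X X *:%R (lm p) (lm_linear p)).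
pose Wl : {linear X -> X} :=
  HB.pack W (GRing.isLinear.Build R X X *:%R W (SL2_linear (qpolar r t) lB lT)).
have WZ c y : W (c *: y) = c *: W y by exact: (linearZ_LR Wl).
have TZ c y : T (c *: y) = c *: T y by exact: (linearZ_LR Tl).
have LZ p c y : lm p (c *: y) = c *: lm p y by exact: (linearZ_LR (L p)).
have W1E y : W1 y = W (lm (qpolar r t) y) - T (W y) by rewrite lm_qpolar WZ.
have W1Z c y : W1 (c *: y) = c *: W1 y.
  rewrite /W1 LZ !WZ TZ scalerBr !scalerA.
  by rewrite (mulrC c).
rewrite -W1Z -lm_qpolar; set s := qpolar r t.
apply: (@SL2_recurrence R X Tl (L s) (L (qconj s)) (qre s) (qnorm s ^+ 2) _ _ Bl)
  W1E _ => //=.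
- move=> y; rewrite -(lm_mul hX) -(lm_real hX); congr (lm _ y).
  rewrite qnorm_qpolar //; have /(congr1 ( *%R (r ^+ 2))) := cos2Dsin2 t.
  rewrite mulr1 => <-.
  by rewrite /s qpolarE /qmul /qofR /=; congr Quat; ring.
- move=> y; rewrite -(lm_addl hX) -(lm_real hX); congr (lm _ y).
  by rewrite /s qpolarE /qadd /qofR /=; congr Quat; ring.
- by move=> y; rewrite /W /SL2 (lm_mul hX).
Qed.
End Resolvent.

Set Implicit Arguments. Unset Strict Implicit. Unset Printing Implicit Defensive.

(** * Elementary real estimates *)

Section RealEstimates.
Variable R : realType.

Lemma bernoulli (x : R) n : -1 <= x -> 1 + n%:R * x <= (1 + x) ^+ n.
Proof.
move=> x1; elim: n => [|n IH]; first by rewrite mul0r addr0 expr0.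
rewrite exprS; apply: le_trans (ler_wpM2l _ IH); last by lra.
by rewrite -natr1; have := ler0n R n; nra.
Qed.

(** [m q^m] tends to 0, so the inequality passes to the limit. *)
Lemma ler_decay (q D a b : R) M : 0 < q < 1 -> 0 <= D ->
  (forall m, (M <= m)%N -> a <= b + D * (m%:R * q ^+ m)) -> a <= b.
Proof.
move=> /andP[q0 q1] D0 H; rewrite leNgt; apply/negP => ba.
(* Bernoulli for [1/x = 1 + h] gives [m h x^m <= 1]; squaring gives [m q^m <= 1/(m h^2)]. *)
pose x : R := Num.sqrt q; have x0 : 0 < x by rewrite sqrtr_gt0.
have x1 : x < 1 by rewrite -sqrtr1 ltr_sqrt.
have qE : q = x * x by rewrite -expr2 sqr_sqrtr // ltW.
pose h : R := x^-1 - 1; have h0 : 0 < h by rewrite subr_gt0 invf_gt1.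
have hE : x^-1 = 1 + h by rewrite /h addrC subrK.
clearbody h.
pose m := maxn M (Num.bound (D / (h ^+ 2 * (a - b)))).+1.
have m0 : 0 < m%:R :> R by rewrite ltr0n leq_max orbT.
have xm : m%:R * h * x ^+ m <= 1.
  rewrite -ler_pdivlMr ?exprn_gt0 // mul1r -exprVn hE.
  have h1 : -1 <= h by lra.
  by have := bernoulli m h1; lra.
have qm : m%:R * q ^+ m <= (m%:R * h ^+ 2)^-1.
  rewrite -[leRHS]mul1r ler_pdivlMr ?mulr_gt0 ?exprn_gt0 //.
  have -> : m%:R * q ^+ m * (m%:R * h ^+ 2) = (m%:R * h * x ^+ m) ^+ 2.
    by rewrite qE exprMn; ring.
  by rewrite expr_le1 // !mulr_ge0 ?exprn_ge0 // ltW.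
have mb : D / (h ^+ 2 * (a - b)) < m%:R.
  apply: lt_le_trans (_ : (Num.bound (D / (h ^+ 2 * (a - b))))%:R <= _).
    by apply: archi_boundP; rewrite divr_ge0 // mulr_ge0 ?exprn_ge0 ?ltW // subr_gt0.
  by rewrite ler_nat leq_max leqnSn orbT.
have : D * (m%:R * q ^+ m) < a - b.
  apply: le_lt_trans (ler_wpM2l D0 qm) _; move: mb.
  rewrite !ltr_pdivrMr ?mulr_gt0 ?exprn_gt0 ?subr_gt0 //.
  by have -> : m%:R * (h ^+ 2 * (a - b)) = (a - b) * (m%:R * h ^+ 2) by ring.
by rewrite ltrBrDl => /(le_lt_trans (H m (leq_maxl _ _))); rewrite ltxx.
Qed.
End RealEstimates.

(** * Solving the periodic recurrences for [b] and [A] *)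

Section Iterates.
Variables (R : realType) (X : lmodType R) (T : {linear X -> X}).

Fact iter_linear n : linear (iter n T).
Proof. by elim: n => [|n IH] c u v //=; rewrite IH linearP. Qed.

HB.instance Definition _ n := GRing.isLinear.Build R X X *:%R (iter n T) (iter_linear n).

Variables (r : R) (N : nat) (A b : nat -> X) (v : X).
Hypothesis bE : forall j, b j = r *: A j.+1 - T (A j).
Hypothesis b_rec0 : r *: b 1%N - T (b 0%N) = v.
Hypothesis b_rec : forall j, (0 < j <= N)%N -> r *: b j.+1 - T (b j) = 0.
Hypothesis A_periodic : A N.+2 = A 1%N.
Hypothesis b_periodic : b N.+1 = b 0%N.

Let TZ c x : T (c *: x) = c *: T x. Proof. exact: linearZ_LR. Qed.
Let iterZ n c x : iter n T (c *: x) = c *: iter n T x.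
Proof. exact: (linearZ_LR (iter n T)). Qed.

Let iterB n x y : iter n T (x - y) = iter n T x - iter n T y.
Proof. exact: (linearB (iter n T)). Qed.
Let iterDv n x y : iter n T (x + y) = iter n T x + iter n T y.
Proof. exact: (linearD (iter n T)). Qed.

Lemma b_iter j : (j <= N)%N -> r ^+ j *: b j.+1 = iter j T (b 1%N).
Proof.
elim: j => [|j IH] jN; first by rewrite scale1r.
have /eqP := @b_rec j.+1 jN; rewrite subr_eq0 => /eqP e.
by rewrite exprSr -scalerA e -TZ IH // ltnW.
Qed.

(** One full turn of length [N.+1]: [b] evolves freely from index 1 to [N.+1], which is index 0
    again, and the step back to 1 adds the source [v]. *)
Lemma b_source : r ^+ N.+1 *: b 1%N = iter N.+1 T (b 1%N) + r ^+ N *: v.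
Proof.
rewrite -b_rec0 scalerBr scalerA -exprSr -b_periodic -TZ.
by rewrite b_iter // addrC subrK.
Qed.

(** [A] is driven by [b], itself a solution of the homogeneous equation; this resonance produces the
    factor [j.+1], from which the gain [n.+1] in the growth estimate comes. *)
Lemma A_iter j : (j <= N)%N ->
  r ^+ j.+1 *: A j.+2 = iter j.+1 T (A 1%N) + j.+1%:R *: iter j T (b 1%N).
Proof.
have A_step i : r *: A i.+2 = T (A i.+1) + b i.+1 by rewrite bE addrC subrK.
elim: j => [|j IH] jN; first by rewrite expr1 A_step scale1r.
rewrite exprSr -scalerA A_step scalerDr b_iter // -TZ IH ?(ltnW jN) //.
by rewrite linearD TZ /= -addrA -(natr1 j.+1) scalerDl scale1r.
Qed.

(** [A_iter] at [n] gives [(n+1) T^n b_1] in terms of [A_(n+2)] and [A_1]; [b_source] trades [b_1]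
    for [v], and [A_iter] over a full turn pushes [A_1] to high powers of [T]. These are negligible
    against [r ^+ N] when [T] grows at a rate below [r]. *)
Lemma periodic_recurrence n : (n <= N)%N ->
  r ^+ N *: (n.+1%:R *: iter n T v) =
  r ^+ (N + n.+2) *: A n.+2 - iter (N + n.+2) T (A 1%N)
  - (N + n.+2)%:R *: iter (N + n.+1) T (b 1%N).
Proof.
move=> nN.
have eA1 : r ^+ N.+1 *: A 1%N = iter N.+1 T (A 1%N) + N.+1%:R *: iter N T (b 1%N).
  by rewrite -A_iter // A_periodic.
have eb1 : n.+1%:R *: iter n T (b 1%N) = r ^+ n.+1 *: A n.+2 - iter n.+1 T (A 1%N).
  by rewrite A_iter // addrC addKr.
have ev : r ^+ N *: v = r ^+ N.+1 *: b 1%N - iter N.+1 T (b 1%N).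
  by rewrite b_source addrC addKr.
rewrite scalerA mulrC -scalerA -(iterZ n (r ^+ N) v) ev iterB iterZ -iterD.
rewrite scalerBr scalerA mulrC -scalerA eb1 scalerBr scalerA -exprD.
rewrite -(iterZ n.+1) eA1 iterDv iterZ -!iterD.
have -> : (N.+1 + n.+1 = N + n.+2)%N by rewrite addSnnS.
have -> : (n.+1 + N.+1 = N + n.+2)%N by rewrite addnC addSnnS.
have -> : (n.+1 + N = N + n.+1)%N by rewrite addnC.
have -> : (n + N.+1 = N + n.+1)%N by rewrite addnC addSnnS.
by rewrite opprD -!addrA -[X in _ + (_ + X)]opprD -scalerDl -natrD addSnnS.
Qed.
End Iterates.

(** * Growth of the powers of [T] *)

Section Growth.
Variables (R : realType) (X : completeNormedModType R)
  (lm : quat R -> X -> X) (rm : X -> quat R -> X).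
Hypothesis hX : two_sided_qbanach lm rm.

(** In [d^2 = d^(1-alpha) d^(1+alpha)] the first factor is at most [(r+1)^(1-alpha) <= r + 1]. The
    bound [d <= r + 1] holds for [d = |s - 1|] on the circle [|s| = r]. *)
Lemma powR_le_sqr (C alpha r d : R) : 0 <= C -> 0 < alpha -> alpha <= 1 ->
  1 < r -> 0 < d -> d <= r + 1 ->
  C / d `^ (1 + alpha) <= C * (r + 1) / d ^+ 2.
Proof.
move=> C0 a0 a1 r1 d0 dr; rewrite -mulrA ler_wpM2l //.
rewrite ler_pdivlMr ?exprn_gt0 // mulrC ler_pdivrMr ?powR_gt0 //.
have -> : d ^+ 2 = d `^ (1 - alpha) * d `^ (1 + alpha).
  by rewrite -powRD ?(gt_eqF d0) ?implybT // -powR_mulrn ?ltW //; congr powR; ring.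
rewrite ler_wpM2r ?powR_ge0 //.
apply: (@le_trans _ _ ((r + 1) `^ (1 - alpha))).
  by rewrite ge0_ler_powR // ?nnegrE; lra.
by rewrite -[leRHS]powRr1 ?ler_powR; lra.
Qed.

Lemma sum_lm_qcis (I : Type) (s : seq I) (f : I -> R) v :
  \sum_(k <- s) lm (qcis (f k)) v =
  lm (Quat (\sum_(k <- s) cos (f k)) (\sum_(k <- s) sin (f k)) 0 0) v.
Proof.
elim: s => [|k s IH]; first by rewrite !big_nil (lm_real hX 0) scale0r.
rewrite !big_cons IH -(lm_addl hX); congr (lm _ v).
by rewrite /qadd /= !addr0.
Qed.

Variables (T : {linear X -> X}) (C alpha : R).
Hypotheses (hT : in_BX rm T) (C0 : 0 < C) (alpha0 : 0 < alpha) (alpha1 : alpha <= 1).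
Hypothesis hrho : forall s : quat R, 1 < qnorm s -> rhoS rm T s.
Hypothesis hSL2 : forall s : quat R, 1 < qnorm s ->
  forall B : X -> X, BX_inverse rm B (Qs s T) ->
  opnorm_le (SL2 lm B s T) (C / qnorm (qsub s (qofR 1)) `^ (1 + alpha)).

Lemma slice_resolvent (r t : R) : 1 < r -> exists W : X -> X,
  (forall x, `|W x| <= C * (r + 1) * (r ^+ 2 - 2 * r * cos t + 1)^-1 * `|x|) /\
  let W1 y := r *: W (lm (qcis t) y) - T (W y) in
  forall x, r *: W1 (lm (qcis t) x) - T (W1 x) = x.
Proof.
move=> r1; have r0 : 0 <= r by lra.
set s := qpolar r t; have ns : qnorm s = r by apply: qnorm_qpolar.
have s1 : 1 < qnorm s by rewrite ns.
have [B hB] := hrho s1; exists (SL2 lm B s T); split; last exact: slice_recurrence hB.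
move=> x; apply: le_trans (hSL2 s1 hB x) _; rewrite ler_wpM2r //.
have den0 := poisson_denom_gt0 t r1.
have := qnorm_qpolar_sub1 r t; rewrite -/s; set d := qnorm _ => dE.
have d2 : r ^+ 2 - 2 * r * cos t + 1 = d ^+ 2 by rewrite dE sqr_sqrtr // ltW.
rewrite d2; apply: powR_le_sqr => //; [exact: ltW | by rewrite dE sqrtr_gt0 |].
rewrite -ler_sqr ?nnegrE ?dE ?sqrtr_ge0 //; last lra.
rewrite -dE -d2; have := cos_geN1 t; nra.
Qed.

Lemma slice_averages (r : R) N (v : X) : 1 < r -> 2 <= r ^+ N.+1 ->
  exists A : nat -> X, let b j := r *: A j.+1 - T (A j) in
  [/\ forall j, A (j + N.+1)%N = A j,
      forall j, `|A j| <= 3 * C / (r - 1) * `|v|,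
      r *: b 1%N - T (b 0%N) = v &
      forall j, (0 < j <= N)%N -> r *: b j.+1 - T (b j) = 0].
Proof.
move=> r1 rN; set w := root_angle R N.+1.
have [W HW] := choice (fun k : nat => slice_resolvent (k%:R * w) r1).
(* [e j k] is [s^j v / r^j] for the [k]-th point [s] of the circle. *)
pose e (j k : nat) := lm (qcis ((j * k)%:R * w)) v.
pose A j := N.+1%:R^-1 *: \sum_(k < N.+1) W k (e j k).
have NR : N.+1%:R != 0 :> R by rewrite pnatr_eq0.
have TZ c x : T (c *: x) = c *: T x by exact: linearZ_LR.
have Tsum (F : 'I_N.+1 -> X) : T (\sum_(k < N.+1) F k) = \sum_(k < N.+1) T (F k).
  exact: linear_sum.
have eS j k : e j.+1 k = lm (qcis (k%:R * w)) (e j k).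
  by rewrite /e -(lm_qcisD hX) -mulrDl -natrD mulSn.
(* The slice recurrence passes to averages; its source becomes the mean of [e j k] over [k], which
   orthogonality of the roots of unity turns into [v] or 0. *)
have rec j : let b j := r *: A j.+1 - T (A j) in
    r *: b j.+1 - T (b j) = N.+1%:R^-1 *: \sum_(k < N.+1) e j k.
  have bE i : r *: A i.+1 - T (A i) =
     N.+1%:R^-1 *: \sum_(k < N.+1) (r *: W k (e i.+1 k) - T (W k (e i k))).
    rewrite /A TZ sumrB scalerBr -scaler_sumr !scalerA (mulrC r).
    by rewrite Tsum.
  rewrite /= !bE TZ scalerA mulrC -scalerA -scalerBr; congr (_ *: _).
  rewrite scaler_sumr Tsum -sumrB; apply: eq_bigr => k _ /=.
  by have [_ /(_ (e j k))] := HW k; rewrite /= !eS.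
exists A; split=> [j|j||j /andP[j0 jN]].
- congr (_ *: _); apply: eq_bigr => k _; congr (W _ _).
  rewrite /e /qcis; have -> := root_angle_shift R j k (ltn0Sn N).
  by rewrite (periodicn (@cosD2pi R)) (periodicn (@sinD2pi R)).
- rewrite normrZ ger0_norm ?invr_ge0 ?ler0n // mulrC ler_pdivrMr ?ltr0n //.
  apply: le_trans (ler_norm_sum _ _ _) _.
  apply: le_trans (_ : \sum_(k < N.+1) (C * (r + 1) * `|v|) *
     (r ^+ 2 - 2 * r * cos (k%:R * w) + 1)^-1 <= _).
    apply: ler_sum => k _; have [h _] := HW k; apply: le_trans (h _) _.
    by rewrite (norm_lm_qcis hX) mulrAC.
  (* The factor [r + 1] cancels against the [r^2 - 1] of the Poisson sum. *)
  rewrite -mulr_sumr; have := discrete_poisson r1 rN; rewrite -/w => h.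
  have c0 : 0 <= C * (r + 1) * `|v| by rewrite !mulr_ge0 // ?ltW //; lra.
  apply: le_trans (ler_wpM2l c0 h) _; rewrite le_eqVlt; apply/orP; left; apply/eqP.
  have r10 : r - 1 != 0 by rewrite gt_eqF // subr_gt0.
  have r11 : r ^+ 2 - 1 != 0 by rewrite gt_eqF // subr_gt0 exprn_egt1.
  by field; rewrite r10 r11.
- rewrite rec; under eq_bigr => k _ do rewrite /e mul0n mul0r /qcis cos0 sin0 (lm_one hX).
  by rewrite sumr_const card_ord -(scaler_nat _ v) scalerA mulVf // scale1r.
- rewrite rec /e sum_lm_qcis.
  have [|-> ->] := @sum_root_angle R N.+1 j; first by rewrite j0 ltnS.
  by rewrite (lm_real hX 0) scale0r scaler0.
Qed.

Definition growth_le (K r : R) : Prop :=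
  forall n v, `|iter n T v| <= K * r ^+ n * `|v|.

Lemma growth_le_sub K r r' : 0 <= K -> 0 <= r <= r' -> growth_le K r -> growth_le K r'.
Proof.
move=> K0 /andP[r0 rr'] h n v; apply: le_trans (h n v) _.
by rewrite ler_wpM2r // ler_wpM2l // lerXn2r // nnegrE // (le_trans r0).
Qed.

(** Divide [m] by [n] with remainder: each block [T^n] costs [p^n], and the remainder, shorter than
    [n], costs at most [K (r/p)^n] beyond the rate [p]. *)
Lemma growth_le_power (K r p : R) n : 0 <= K -> 0 < p <= r -> (0 < n)%N ->
  growth_le K r -> (forall v, `|iter n T v| <= p ^+ n * `|v|) ->
  growth_le (K * (r / p) ^+ n) p.
Proof.
move=> K0 /andP[p0 pr] n0 hr hp m v.
have iter_mul k x : `|iter (k * n) T x| <= p ^+ (k * n) * `|x|.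
  elim: k x => [|k IH] x; first by rewrite mul0n expr0 mul1r.
  rewrite mulSn iterD exprD -mulrA; apply: le_trans (hp _) _.
  by rewrite ler_wpM2l ?exprn_ge0 // ltW.
have rp1 : 1 <= r / p by rewrite ler_pdivlMr // mul1r.
set k := (m %/ n)%N; set i := (m %% n)%N.
have mE : m = (k * n + i)%N by apply: divn_eq.
have P0 : 0 <= p ^+ (k * n) by rewrite exprn_ge0 // ltW.
rewrite mE iterD; apply: le_trans (iter_mul _ _) _.
apply: le_trans (ler_wpM2l P0 (hr i v)) _.
rewrite !mulrA ler_wpM2r // exprD.
have -> : r ^+ i = (r / p) ^+ i * p ^+ i by rewrite -exprMn divfK // gt_eqF.
have Z0 : 0 <= K * p ^+ (k * n) * p ^+ i by rewrite !mulr_ge0 ?exprn_ge0 // ltW.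
have := ler_wpM2l Z0 (ler_weXn2l rp1 (ltnW (ltn_pmod m n0))); rewrite -/i => h.
by move: h; congr (_ <= _); ring.
Qed.

(** The period in [periodic_recurrence] tends to infinity. The error terms decay like [m (r0/r)^m],
    so neither [K] nor [r0] survives in the bound. *)
Lemma growth_estimate (K r0 r : R) : 0 <= K -> 0 < r0 < r -> 1 < r ->
  growth_le K r0 -> forall n v,
  n.+1%:R * `|iter n T v| <= r ^+ n.+2 * (3 * C / (r - 1) * `|v|).
Proof.
move=> K0 /andP[r00 r0r] r1 hK n v; set a := 3 * C / (r - 1) * `|v|.
have rp : 0 < r by lra.
have [rp' r00' r1' C0'] : [/\ 0 <= r, 0 <= r0, 0 <= r - 1 & 0 <= C].
  by split; rewrite ?subr_ge0 ltW.
have a0 : 0 <= a.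
  by rewrite mulr_ge0 // divr_ge0 // mulr_ge0.
have aE : 3 * C / (r - 1) * `|v| = a by []; clearbody a.
(* [beta] will bound [b 1 = r A_2 - T A_1]; the norm of [T] is at most [K r0] by [hK] at 1. *)
pose beta := r * a + K * r0 * a.
have beta0 : 0 <= beta by rewrite addr_ge0 ?mulr_ge0.
pose D := K * a + K * beta / r0.
have D0 : 0 <= D by rewrite addr_ge0 ?mulr_ge0 // invr_ge0.
(* The threshold makes [N = m - n - 2] at least [n], as the recurrence requires, and at least
   [1/(r-1)], so that [r ^+ N.+1] reaches 2 by Bernoulli. *)
apply: (@ler_decay R (r0 / r) (r ^+ n.+2 * D) _ _ (n.+2 + maxn n (Num.bound (r - 1)^-1))).
- by rewrite divr_gt0 //= ltr_pdivrMr // mul1r.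
- by rewrite mulr_ge0 // exprn_ge0.
move=> m Mm; pose N := (m - n.+2)%N.
have mE : m = (N + n.+2)%N by rewrite subnK // (leq_trans _ Mm) // leq_addr.
have : (maxn n (Num.bound (r - 1)^-1) <= N)%N.
  by move: Mm; rewrite mE addnC leq_add2r.
rewrite geq_max => /andP[nN boundN].
have rN : 2 <= r ^+ N.+1.
  have /(bernoulli N.+1) : -1 <= r - 1 by lra.
  have : (r - 1)^-1 < N.+1%:R.
    apply: lt_le_trans (archi_boundP _) _; first by rewrite invr_ge0; lra.
    by rewrite ler_nat (leq_trans boundN).
  rewrite -[X in X < _]mul1r ltr_pdivrMr ?subr_gt0 // => h.
  by rewrite (addrC 1 (r - 1)) subrK; lra.
have [A [per]] := slice_averages v r1 rN; rewrite aE => An b0 brec.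
pose b j := r *: A j.+1 - T (A j).
have bper : b N.+1 = b 0%N by rewrite /b (per 1%N) (per 0%N).
have := periodic_recurrence (fun=> erefl) b0 brec (per 1%N) bper nN.
rewrite -mE => /(congr1 (fun x => `|x|)).
rewrite normrZ normrZ ger0_norm ?exprn_ge0  // [`|n.+1%:R|]ger0_norm ?ler0n // => E.
have hT1 x : `|T x| <= K * r0 * `|x| by have := hK 1%N x; rewrite expr1.
have hb : `|b 1%N| <= beta.
  apply: le_trans (ler_normB _ _) _; apply: lerD.
    by rewrite normrZ ger0_norm  // ler_wpM2l .
  by apply: le_trans (hT1 _) _; rewrite ler_wpM2l // mulr_ge0 .
have key : r ^+ N * (n.+1%:R * `|iter n T v|) <=
    r ^+ m * a + K * r0 ^+ m * a + m%:R * (K * r0 ^+ (N + n.+1) * beta).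
  rewrite E; apply: le_trans (ler_normB _ _) _; apply: lerD.
    apply: le_trans (ler_normB _ _) _; apply: lerD.
      by rewrite normrZ ger0_norm ?exprn_ge0  // ler_wpM2l ?exprn_ge0 .
    by apply: le_trans (hK _ _) _; rewrite ler_wpM2l // mulr_ge0 ?exprn_ge0.
  rewrite normrZ ger0_norm ?ler0n // ler_wpM2l ?ler0n //.
  by apply: le_trans (hK _ _) _; rewrite ler_wpM2l // mulr_ge0 ?exprn_ge0.
rewrite -(ler_pM2l (exprn_gt0 N rp)); apply: le_trans key _.
(* This lets the error in [a] acquire a factor [m], so that [D] absorbs both errors; the [/ r0] in
   [D] makes up for the exponent [N + n.+1 = m - 1]. *)
have m1 : 1 <= m%:R :> R by rewrite ler1n mE addnS.
have -> : r0 ^+ m = r0 ^+ (N + n.+1) * r0 by rewrite mE addnS exprSr.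
have -> : r ^+ N * (r ^+ n.+2 * a + r ^+ n.+2 * D * (m%:R * (r0 / r) ^+ m)) =
    r ^+ m * a + m%:R * (K * (r0 ^+ (N + n.+1) * r0) * a) +
    m%:R * (K * r0 ^+ (N + n.+1) * beta).
  have -> : (r0 / r) ^+ m = r0 ^+ (N + n.+1) * r0 / (r ^+ N * r ^+ n.+2).
    by rewrite -exprD -mE -exprSr -addnS -mE expr_div_n.
  have -> : r ^+ m = r ^+ N * r ^+ n.+2 by rewrite -exprD -mE.
  by rewrite /D; field; rewrite !expf_neq0 ?gt_eqF.
by rewrite lerD2r lerD2l ler_peMl // !mulr_ge0 ?exprn_ge0.
Qed.

(** One [p] serves every [K] and every rate in the range; this uniformity lets finitely many
    descents reach [rs]. *)
Lemma growth_descent (rs R0 : R) : 1 < rs -> rs <= R0 -> exists2 p : R, 0 < p < 1 &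
  forall K r0, 0 <= K -> rs <= r0 <= R0 -> growth_le K r0 ->
  exists2 K', 0 <= K' & growth_le K' (p * r0).
Proof.
(* [L] bounds [3 C r^2 / (r - 1)] for [rs <= r <= 2 R0]; the 2 leaves room for [r = r0 / p] with
   [p >= 1/2]. *)
move=> rs1 rsR; pose L := 3 * C * (2 * R0) ^+ 2 / (rs - 1).
have C0' : 0 <= C by apply: ltW.
have rs1' : 0 <= rs - 1 by rewrite subr_ge0 ltW.
have L0 : 0 <= L by rewrite divr_ge0 // mulr_ge0 ?sqr_ge0 // mulr_ge0.
pose n := (Num.bound (4 * L)).+1.
have nL : 4 * L <= n.+1%:R.
  apply: ltW; apply: lt_le_trans (archi_boundP _) _; first by rewrite mulr_ge0.
  by rewrite ler_nat leqW.
have n1 : 1 <= n%:R :> R by rewrite ler1n.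
clearbody n.
(* By Bernoulli [p^(2n) >= 1/4], while [n + 1 >= 4 L] turns the estimate at [r = r0 / p] into [|T^n
   v| <= r^n |v| / 4 <= (p^2 r)^n |v| = (p r0)^n |v|]. *)
pose p : R := 1 - (4 * n%:R)^-1.
have n4 : 0 < (4 * n%:R)^-1 :> R by rewrite invr_gt0; lra.
have n41 : (4 * n%:R)^-1 <= 4^-1 :> R by rewrite lef_pV2 ?posrE; lra.
have [p0 p1 p12] : [/\ 0 < p, p < 1 & 2^-1 <= p] by rewrite /p; split; lra.
exists p; first by rewrite p0.
move=> K r0 K0 /andP[rsr0 r0R] hK.
have r00 : 0 < r0 by lra.
pose r := r0 / p.
have rr0 : r * p = r0 by rewrite /r divfK ?gt_eqF.
have r0r : r0 < r by rewrite ltr_pdivlMr // gtr_pMr.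
have rR : r <= 2 * R0 by rewrite ler_pdivrMr //; nra.
clearbody r.
have pn : 4^-1 <= p ^+ (n + n).
  have /(bernoulli (n + n)) : -1 <= - (4 * n%:R)^-1 :> R by lra.
  rewrite natrD -/p; apply: le_trans.
  have -> : (n%:R + n%:R) * - (4 * n%:R)^-1 = - 2^-1 :> R by field; lra.
  by lra.
have power v : `|iter n T v| <= (p * r0) ^+ n * `|v|.
  have r1 : 1 < r by lra.
  have rn0 : 0 <= r ^+ n * `|v| by rewrite mulr_ge0 ?exprn_ge0 //; lra.
  have h1 : n.+1%:R * `|iter n T v| <= L * (r ^+ n * `|v|).
    have r0r' : 0 < r0 < r by rewrite r00.
    apply: le_trans (growth_estimate K0 r0r' r1 hK n v) _.
    have -> : r ^+ n.+2 * (3 * C / (r - 1) * `|v|) =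
       (3 * C * r ^+ 2 / (r - 1)) * (r ^+ n * `|v|).
      by rewrite -addn2 exprD; ring.
    rewrite ler_wpM2r //; apply: ler_pM.
    - by rewrite mulr_ge0 ?sqr_ge0 // mulr_ge0.
    - by rewrite invr_ge0; lra.
    - by rewrite ler_wpM2l ?mulr_ge0 // lerXn2r // nnegrE; lra.
    - by rewrite lef_pV2 ?posrE; lra.
  have h2 : n.+1%:R * `|iter n T v| <= n.+1%:R * (4^-1 * (r ^+ n * `|v|)).
    apply: le_trans h1 _; rewrite mulrA ler_wpM2r //; lra.
  move: h2; rewrite ler_pM2l ?ltr0n // => /le_trans; apply.
  have -> : p * r0 = p * p * r by rewrite -rr0; ring.
  by rewrite !exprMn -exprD -mulrA ler_wpM2r.
have pr0 : 0 < p * r0 <= r0 by rewrite mulr_gt0 //= ger_pMl // ltW.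
exists (K * (r0 / (p * r0)) ^+ n).
  by rewrite mulr_ge0 // exprn_ge0 // divr_ge0 ?mulr_ge0 // ltW.
by apply: growth_le_power => //; rewrite -(ltr0n R); lra.
Qed.

Lemma growth_above1 (rs : R) : 1 < rs -> exists2 K, 0 <= K & growth_le K rs.
Proof.
move=> rs1; have [_ [_ [K0 hK0]]] := hT.
pose R0 := Num.max rs K0.
have rsR : rs <= R0 by rewrite le_max lexx.
have R00 : 0 < R0 by lra.
have base : growth_le 1 R0.
  move=> n v; rewrite mul1r; elim: n => [|n IH]; first by rewrite mul1r.
  rewrite exprS -mulrA; apply: le_trans (hK0 _) _.
  apply: (@le_trans _ _ (R0 * `|iter n T v|)); last by rewrite ler_wpM2l // ltW.
  by rewrite ler_wpM2r // le_max lexx orbT.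
have [p /andP[p0 p1] step] := growth_descent rs1 rsR.
(* The maximum with [rs] keeps the rate in the range where [p] works. *)
have iterate m : exists2 K, 0 <= K & growth_le K (Num.max rs (p ^+ m * R0)).
  elim: m => [|m [K K00 hK]].
    by exists 1 => //; rewrite mul1r; have -> : Num.max rs R0 = R0 by apply/max_idPr.
  have [|K' K'0 hK'] := step K _ K00 _ hK.
    rewrite le_max lexx /= ge_max rsR /= ger_pMl //.
    by rewrite exprn_ile1 // ltW.
  exists K' => //; apply: growth_le_sub hK' => //.
  have M0 : 0 < Num.max rs (p ^+ m * R0) by rewrite lt_max; apply/orP; left; lra.
  rewrite mulr_ge0 ?(ltW p0) ?(ltW M0) //= maxr_pMr ?(ltW p0) // ge_max !le_max.
  apply/andP; split; last by rewrite mulrA -exprS lexx orbT.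
  by rewrite ger_pMl ?(ltW p1) //; lra.
have [m hm] : exists m, p ^+ m * R0 <= rs.
  pose h := p^-1 - 1; have h0 : 0 < h by rewrite subr_gt0 invf_gt1.
  exists (Num.bound (R0 / h)); set m := Num.bound _.
  have hm : R0 < m%:R * h.
    by rewrite -ltr_pdivrMr // archi_boundP // divr_ge0 // ltW.
  have /(bernoulli m) : -1 <= h by lra.
  have -> : 1 + h = p^-1 by rewrite /h addrC subrK.
  rewrite exprVn -[leRHS]mul1r ler_pdivlMr ?exprn_gt0 // => hb.
  have : R0 * p ^+ m <= (1 + m%:R * h) * p ^+ m.
    by rewrite ler_wpM2r ?exprn_ge0 ?ltW //; lra.
  lra.
have [K K00 hK] := iterate m; exists K => //.
by move: hK; have -> : Num.max rs (p ^+ m * R0) = rs by apply/max_idPl.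
Qed.

Lemma growth_power_bounded : power_bounded T.
Proof.
(* With [u = 1/(n+1)] and [r = 1 + u], the factor [1/(r-1)] cancels [n + 1] and [r^(n+2) <= 2 e],
   which leaves [3 C] times [2 e]. *)
exists (6 * C * expR 1) => n v.
have n0 : 0 < n.+1%:R :> R by rewrite ltr0n.
have [u [u0 u1 nu uE]] : exists u : R,
    [/\ 0 < u, u <= 1, n.+1%:R * u = 1 & u^-1 = n.+1%:R].
  exists n.+1%:R^-1; split; rewrite ?invr_gt0 ?divff ?gt_eqF ?invrK //.
  by rewrite invf_le1 // ler1n.
have r1 : 1 < 1 + u by lra.
have re : (1 + u) ^+ n.+1 <= expR 1.
  have -> : expR 1 = expR u ^+ n.+1 by rewrite -expRM_natl nu.
  rewrite lerXn2r ?nnegrE ?expR_ge0 ?expR_ge1Dx //.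
  by lra.
(* Any rate strictly between 1 and [r] serves; [K] depends on [n], but [growth_estimate] eliminates
   it. *)
have [|K K0 hK] := @growth_above1 (1 + u / 2); first by lra.
have r01 : 0 < 1 + u / 2 < 1 + u by apply/andP; split; lra.
have := growth_estimate K0 r01 r1 hK n v.
have -> : 1 + u - 1 = u by ring.
rewrite uE.
have -> : (1 + u) ^+ n.+2 * (3 * C * n.+1%:R * `|v|) =
   n.+1%:R * ((1 + u) * (1 + u) ^+ n.+1 * (3 * C * `|v|)).
  by rewrite [_ ^+ n.+2]exprS; ring.
rewrite ler_pM2l // => /le_trans; apply.
have -> : 6 * C * expR 1 * `|v| = 2 * expR 1 * (3 * C * `|v|) by ring.
rewrite ler_wpM2r ?mulr_ge0 ?(ltW C0) //.
by apply: ler_pM => //; rewrite ?exprn_ge0 //; lra.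
Qed.
End Growth.

Unset Implicit Arguments. Set Strict Implicit. Set Printing Implicit Defensive.

Theorem theorem3p8 (R : realType) (X : completeNormedModType R)
  (lm : quat R -> X -> X) (rm : X -> quat R -> X)
  (hX : two_sided_qbanach lm rm) (T : X -> X) (hT : in_BX rm T) :
  (forall s : quat R, qnorm s = 1 -> s <> qofR 1 -> rhoS rm T s) ->
  (forall s : quat R, 1 < qnorm s -> rhoS rm T s) ->
  (exists (C alpha : R), 0 < C /\ 0 < alpha /\ alpha <= 1 /\
     forall s : quat R, 1 < qnorm s ->
     forall B : X -> X, BX_inverse rm B (Qs s T) ->
       opnorm_le (SL2 lm B s T) (C / qnorm (qsub s (qofR 1)) `^ (1 + alpha))) ->
  power_bounded T.
Proof.
move=> _ hrho [C [alpha [C0 [alpha0 [alpha1 hSL2]]]]].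
pose Tl : {linear X -> X} :=
  HB.pack T (GRing.isLinear.Build R X X *:%R T (in_BX_linear hX hT)).
exact: (growth_power_bounded hX (T := Tl) hT C0 alpha0 alpha1 hrho hSL2).
Qed.
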